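(* Let $p$ be prime, $m\ge1$, and $R=\mathbb Z_{p^m}[x_1^{\pm1},\dots,x_D^{\pm1}]$. For any sequence $\mathbf f=(f_1,\dots,f_s)$ in $R$ (not necessarily regular), any $\mathbf L\in\mathbb Z_{>0}^D$, and any $0\le j\le s$, there is an isomorphism of $R$-modules $$\overline{\mathcal H_j^Z(\mathbf L)^\ast}\;\cong_R\;\mathcal H_{s-j}^Z(\mathbf L),$$ where $\overline{(-)^\ast}=\overline{\operatorname{Hom}_{\mathbb Z_{p^m}}(-,\mathbb Z_{p^m})}$ is equipped with the $R$-action $(r*\lambda)(m)=\lambda(rm)$. Consequently, $k_j(\mathbf L)=k_{s-j}(\mathbf L)$.
   Context: For $\mathbf L=(L_1,\dots,L_D)$, $R_{\mathbf L}:=R/(x_1^{L_1}-1,\dots,x_D^{L_D}-1)$. The Koszul complex $K_\bullet(\mathbf f)$: $K_i(\mathbf f)=\bigwedge^iR^s$, $\partial_i(e_{a_1}\wedge\cdots\wedge e_{a_i})=\sum_{k=1}^i(-1)^{k-1}f_{a_k}e_{a_1}\wedge\cdots\widehat{e_{a_k}}\cdots\wedge e_{a_i}$; $K_\bullet(\mathbf f;R_{\mathbf L}):=K_\bullet(\mathbf f)\otimes_RR_{\mathbf L}$. Set $\mathcal H_j^Z(\mathbf L):=H_j(K_\bullet(\mathbf f;R_{\mathbf L}))$ and $k_j(\mathbf L):=\log_p|\mathcal H_j^Z(\mathbf L)|$. *)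

(* Defs.v *)
From HB Require Import structures.
From mathcomp Require Import all_boot all_order all_algebra.
From mathcomp Require Import fingroup pgroup cyclic zify ring.
From mathcomp Require Import finmap generic_quotient ring_quotient.
From mathcomp Require Import monalg.
From mathcomp Require Import boolp classical_sets functions cardinality.

Set Implicit Arguments.
Unset Strict Implicit.
Unset Printing Implicit Defensive.

Import Order.TTheory GRing.Theory.

Local Open Scope ring_scope.
Local Open Scope quotient_scope.

(* The Laurent polynomial ring A[x_1^{+-1}, ..., x_D^{+-1}] is the group       *)
(* algebra of Z^D: a Laurent polynomial is a finitely supported family of     *)
(* coefficients indexed by exponent vectors.  {malg _[_]} is a ring in the    *)
(* library only for monoids without nontrivial units, so only its module      *)
(* structure is reused, and the product is redefined on the alias laurent.    *)
Definition laurent (D : nat) (A : comNzRingType) := {malg A['rV[int]_D]}.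

Section LaurentRing.
Variables (D : nat) (A : comNzRingType).
Local Notation K := 'rV[int]_D.
Local Notation R := (laurent D A).
Implicit Types (g : R).

HB.instance Definition _ := GRing.Lmodule.on R.

Definition lmul (g1 g2 : R) : R :=
  \sum_(k1 <- msupp g1) \sum_(k2 <- msupp g2)
     << g1@_k1 * g2@_k2 *g k1 + k2 >>.

Definition lone : R := << 0 : K >>.

Lemma lmulw (d1 d2 : {fset K}) g1 g2 :
    (msupp g1 `<=` d1)%fset -> (msupp g2 `<=` d2)%fset ->
  lmul g1 g2 = \sum_(k1 <- d1) \sum_(k2 <- d2)
                 << g1@_k1 * g2@_k2 *g k1 + k2 >>.
Proof.
move=> le_d1 le_d2; rewrite /lmul (big_fset_incl _ le_d1) /=.
  apply/eq_bigr=> k1 _; apply/big_fset_incl => // k _ /mcoeff_outdom ->.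
  by rewrite mulr0 monalgU0.
move=> k _ /mcoeff_outdom g1k.
by rewrite big1 => // k' _; rewrite g1k mul0r monalgU0.
Qed.

Lemma lmulUU (c1 c2 : A) (k1 k2 : K) :
  lmul << c1 *g k1 >> << c2 *g k2 >> = << c1 * c2 *g k1 + k2 >>.
Proof. by rewrite (lmulw msuppU_le msuppU_le) !big_seq_fset1 !mcoeffUU. Qed.

Lemma lmulC : commutative lmul.
Proof.
move=> g1 g2; rewrite /lmul exchange_big /=.
apply: eq_bigr => k1 _; apply: eq_bigr => k2 _.
by rewrite mulrC addrC.
Qed.

Lemma lmulDl : left_distributive lmul +%R.
Proof.
move=> g1 g2 g.
rewrite [in RHS](lmulw (fsubsetUl _ (msupp g2)) (fsubset_refl _)).
rewrite [in RHS](lmulw (fsubsetUr (msupp g1) _) (fsubset_refl _)).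
rewrite (lmulw (msuppD_le _ _) (fsubset_refl _)).
rewrite -big_split /=; apply/eq_bigr=> k1 _.
rewrite -big_split /=; apply/eq_bigr=> k2 _.
by rewrite mcoeffD mulrDl monalgUD.
Qed.

Lemma lmulDr : right_distributive lmul +%R.
Proof. by move=> g g1 g2; rewrite lmulC lmulDl !(lmulC g). Qed.

Lemma lmul0 : left_zero 0 lmul.
Proof. by move=> g; rewrite /lmul msupp0 big_seq_fset0. Qed.

Lemma lmulr0 : right_zero 0 lmul.
Proof. by move=> g; rewrite lmulC lmul0. Qed.

Lemma lmul_suml I (r : seq I) (F : I -> R) g :
  lmul (\sum_(i <- r) F i) g = \sum_(i <- r) lmul (F i) g.
Proof. exact: (big_morph (lmul^~ g) (fun _ _ => lmulDl _ _ _) (lmul0 g)). Qed.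

Lemma lmul_sumr I (r : seq I) (F : I -> R) g :
  lmul g (\sum_(i <- r) F i) = \sum_(i <- r) lmul g (F i).
Proof. exact: (big_morph (lmul g) (fun _ _ => lmulDr _ _ _) (lmulr0 g)). Qed.

Lemma laurentE g : g = \sum_(k <- msupp g) (<< g@_k *g k >> : R).
Proof. exact: monalgE. Qed.

Lemma lmulA : associative lmul.
Proof.
move=> g1 g2 g3; have lmulAU k1 k2 k3 (c1 c2 c3 : A) :
    lmul << c1 *g k1 >> (lmul << c2 *g k2 >> << c3 *g k3 >>) =
    lmul (lmul << c1 *g k1 >> << c2 *g k2 >>) << c3 *g k3 >>.
  by rewrite !lmulUU mulrA addrA.
rewrite (laurentE g1) !lmul_suml; apply: eq_bigr => k1 _.
rewrite (laurentE g2) lmul_suml !lmul_sumr lmul_suml; apply: eq_bigr => k2 _.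
by rewrite (laurentE g3) !lmul_sumr; apply: eq_bigr => k3 _.
Qed.

Lemma lmul1 : left_id lone lmul.
Proof.
move=> g; rewrite [in LHS](laurentE g) lmul_sumr [RHS]laurentE.
by apply: eq_bigr => k _; rewrite lmulUU mul1r add0r.
Qed.

Lemma lone_neq0 : lone != 0.
Proof. by apply/eqP/malgP=> /(_ 0) /eqP; rewrite !mcoeffsE oner_eq0. Qed.

HB.instance Definition _ := GRing.Zmodule_isComNzRing.Build R
  lmulA lmulC lmul1 lmulDl lone_neq0.

Lemma lscaleE (c : A) g : c *: g = lmul << c *g 0 : K >> g.
Proof.
rewrite (laurentE g) scaler_sumr lmul_sumr; apply: eq_bigr => k _.
rewrite lmulUU add0r.
by apply/malgP=> k'; rewrite mcoeffZ !mcoeffU mulrnAr.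
Qed.

Lemma lscaleAl (c : A) g1 g2 : c *: (g1 * g2) = (c *: g1) * g2.
Proof. by rewrite !lscaleE; apply: lmulA. Qed.

HB.instance Definition _ := GRing.Lmodule_isLalgebra.Build A R lscaleAl.
HB.instance Definition _ := GRing.Lalgebra_isComAlgebra.Build A R.

Definition lvar (i : 'I_D) : R := << delta_mx 0 i >>.

Definition laug : R -> A := mmap idfun (fun=> 1).

Lemma laugB : {morph laug : g1 g2 / g1 - g2}.
Proof. exact: mmapB. Qed.

Lemma laug_sum I (r : seq I) (F : I -> R) :
  laug (\sum_(i <- r) F i) = \sum_(i <- r) laug (F i).
Proof. exact: (big_morph laug (@mmapD _ _ _ _ _) (@mmap0 _ _ _ _ _)). Qed.

Lemma laugU (c : A) (k : K) : laug << c *g k >> = c.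
Proof. by rewrite /laug mmapU mulr1. Qed.

Lemma laugM : {morph laug : g1 g2 / g1 * g2}.
Proof.
move=> g1 g2; rewrite [g1 * g2]/(lmul g1 g2) /lmul laug_sum.
rewrite [laug g1]mmapE [laug g2]mmapE mulr_suml; apply: eq_bigr => k1 _.
rewrite laug_sum mulr_sumr; apply: eq_bigr => k2 _.
by rewrite laugU !mulr1.
Qed.

Lemma laug1 : laug 1 = 1.
Proof. exact: laugU. Qed.
End LaurentRing.

Section Torus.
Variables (D : nat) (A : comNzRingType) (L : 'I_D -> nat).
Local Notation R := (laurent D A).

Definition torus_ideal : {pred R} := fun g =>
  `[< exists c : 'I_D -> R, g = \sum_i c i * (lvar A i ^+ L i - 1) >].

Lemma torus_idealr_closed : idealr_closed torus_ideal.
Proof.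
split.
- apply/asboolP; exists (fun=> 0); rewrite big1 // => i _; exact: mul0r.
- apply/negP => /asboolP[c /(congr1 (@laug _ _))]; rewrite laug1 laug_sum.
  rewrite big1 => [/eqP|i _]; first by rewrite oner_eq0.
  rewrite laugM laugB laug1 [X in X - 1](_ : _ = 1) ?subrr ?mulr0 //.
  by elim: (L i) => [|n IHn]; rewrite ?laug1 // exprS laugM IHn laugU mulr1.
- move=> a _ _ /asboolP[c ->] /asboolP[d ->]; apply/asboolP.
  exists (fun i => a * c i + d i); rewrite mulr_sumr -big_split /=.
  by apply: eq_bigr => i _; rewrite mulrDl mulrA.
Qed.

HB.instance Definition _ := isIdealr.Build R torus_ideal torus_idealr_closed.

Definition torus_ring := {ideal_quot torus_ideal}.

HB.instance Definition _ := GRing.ComNzRing.on torus_ring.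

Definition torus_pi (g : R) : torus_ring := \pi_{ideal_quot torus_ideal} g.

Lemma torus_piM : {morph torus_pi : g h / g * h}.
Proof. exact: (rmorphM (\pi_{ideal_quot torus_ideal})). Qed.

Lemma torus_piD : {morph torus_pi : g h / g + h}.
Proof. exact: (rmorphD (\pi_{ideal_quot torus_ideal})). Qed.

Lemma torus_pi1 : torus_pi 1 = 1.
Proof. exact: (rmorph1 (\pi_{ideal_quot torus_ideal})). Qed.

Definition torus_scale (r : R) (x : torus_ring) : torus_ring := torus_pi r * x.

Lemma torus_scaleA r1 r2 x :
  torus_scale r1 (torus_scale r2 x) = torus_scale (r1 * r2) x.
Proof. by rewrite /torus_scale torus_piM mulrA. Qed.

Lemma torus_scale1 : left_id 1 torus_scale.
Proof. by move=> x; rewrite /torus_scale torus_pi1 mul1r. Qed.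

Lemma torus_scaleDr : right_distributive torus_scale +%R.
Proof. by move=> r x y; rewrite /torus_scale mulrDr. Qed.

Lemma torus_scaleDl x : {morph torus_scale^~ x : r1 r2 / r1 + r2}.
Proof. by move=> r1 r2; rewrite /torus_scale torus_piD mulrDl. Qed.

HB.instance Definition _ := GRing.Zmodule_isLmodule.Build R torus_ring
  torus_scaleA torus_scale1 torus_scaleDr torus_scaleDl.
End Torus.

Section TorusFinite.
Variables (D : nat) (A : finComNzRingType) (L : 'I_D -> nat).
Local Notation K := 'rV[int]_D.
Local Notation R := (laurent D A).

Definition torus_mono (k : K) : torus_ring A L := torus_pi L (<< k >> : R).
Local Notation T := torus_mono.

Lemma torus_pi_monoD k l : T (k + l) = T k * T l.
Proof.
rewrite /torus_mono -torus_piM; congr torus_pi.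
by have := lmulUU (1 : A) 1 k l; rewrite mulr1 => <-.
Qed.

Lemma torus_pi_mono0 : T 0 = 1.
Proof. exact: torus_pi1. Qed.

Lemma torus_pi_period (i : 'I_D) : T (delta_mx 0 i *+ L i) = 1.
Proof.
rewrite -torus_pi1; apply/eqP; rewrite /torus_mono /torus_pi.
rewrite -Quotient.idealrBE.
apply/asboolP; exists (fun j => (j == i)%:R).
rewrite (bigD1 i) //= eqxx mul1r big1 ?addr0 => [|j /negPf->]; last exact: mul0r.
congr (_ - 1); elim: (L i) => [|n IHn]; first by rewrite mulr0n.
have := lmulUU (1 : A) 1 (delta_mx 0 i) (delta_mx 0 i *+ n).
by rewrite exprS -IHn mulr1 mulrS => <-.
Qed.

Lemma torus_ring_finite : (forall i, (0 < L i)%N) ->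
  finite_set [set: torus_ring A L].
Proof.
move=> L_gt0; pose N := \max_i L i.
have LN i : (L i <= N)%N by apply: leq_bigmax.
pose expo (e : {ffun 'I_D -> 'I_N}) : K := \row_i (e i : nat)%:Z.
pose G (h : {ffun {ffun 'I_D -> 'I_N} -> A}) : torus_ring A L :=
  torus_pi L (\sum_e (<< h e *g expo e >> : R)).
suff GP x : exists h, x = G h.
  apply: (sub_finite_set _ (finite_image G (@finite_finset _ setT))).
  by move=> x _; have [h ->] := GP x; exists h.
rewrite -[x]reprK -[X in exists h, X = _]/(torus_pi L (repr x)).
move: (repr x) => g; rewrite (laurentE g).
elim/big_ind: _ => [|g1 g2 [h1 IH1] [h2 IH2]|k _].
- exists [ffun=> 0]; rewrite /G big1 // => e _.
  by rewrite ffunE; apply: monalgU0.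
- exists [ffun e => h1 e + h2 e]; rewrite torus_piD IH1 IH2 -torus_piD -big_split.
  by congr torus_pi; apply: eq_bigr => e _; rewrite ffunE; apply/esym/monalgUD.
have Tper (i : 'I_D) (z : int) : T (delta_mx 0 i *+ L i *~ z) = 1.
  have nat_per n : T (delta_mx 0 i *+ L i *+ n) = 1.
    elim: n => [|n IHn]; first by rewrite mulr0n torus_pi_mono0.
    by rewrite mulrS torus_pi_monoD torus_pi_period IHn mulr1.
  case: z => n; first exact: nat_per.
  rewrite NegzE mulrNz -pmulrn -[LHS]mulr1 -(nat_per n.+1) -torus_pi_monoD.
  by rewrite addNr torus_pi_mono0.
have Tsum (F : 'I_D -> K) : (forall i, T (F i) = 1) -> T (\sum_i F i) = 1.
  move=> TF; elim/big_ind: _ => [|k1 k2 T1 T2|//]; first exact: torus_pi_mono0.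
  by rewrite torus_pi_monoD T1 T2 mulr1.
have Lz (i : 'I_D) : (0 < (L i)%:Z)%R by rewrite ltz_nat.
have Lz0 (i : 'I_D) : (L i)%:Z != 0 by rewrite gt_eqF.
have rem_lt (i : 'I_D) : (`|(k ord0 i %% L i)%Z|%N < N)%N.
  apply: leq_trans (LN i); rewrite -ltz_nat gez0_abs ?modz_ge0 ?ltz_pmod //.
pose e0 := [ffun i => Ordinal (rem_lt i)] : {ffun 'I_D -> 'I_N}.
have Tk : T k = T (expo e0).
  have -> : k = expo e0 + \sum_i delta_mx 0 i *+ L i *~ (k ord0 i %/ L i)%Z.
    have sE (i : 'I_D) z : delta_mx 0 i *+ L i *~ z = ((L i)%:Z * z) *: delta_mx 0 i :> K.
      by rewrite pmulrn -mulrzA -scaler_int intz.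
    apply/rowP => i; rewrite mxE summxE (bigD1 i) //= big1 => [|j /negPf ji].
      rewrite addr0 sE !mxE !eqxx ffunE /= gez0_abs ?modz_ge0 // mulr1.
      by rewrite addrC mulrC -divz_eq.
    by rewrite sE !mxE [i == j]eq_sym ji andbF mulr0.
  by rewrite torus_pi_monoD Tsum ?mulr1.
exists [ffun e => if e == e0 then g@_k else 0].
set h := [ffun e => _].
have -> : G h = torus_pi L (<< g@_k *g expo e0 >> : R).
  congr torus_pi; transitivity (<< h e0 *g expo e0 >> : R).
    apply: big_only1 => // e /negPf ee0 _.
    by rewrite ffunE ee0; apply: monalgU0.
  by rewrite ffunE eqxx.
have scaleT l : torus_pi L (<< g@_k *g l >> : R) = torus_pi L (<< g@_k *g 0 : K >> : R) * T l.
  rewrite /torus_mono -torus_piM; congr torus_pi.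
  by have := lmulUU g@_k 1 0 l; rewrite mulr1 add0r => <-.
by rewrite [LHS]scaleT [RHS]scaleT Tk.
Qed.
End TorusFinite.

Lemma finite_surj (X : choiceType) : finite_set [set: X] ->
  exists (T : finType) (g : T -> X), forall x, exists t, x = g t.
Proof.
move=> /finite_fsetP[F FE]; exists F, val => x.
have xF : x \in F by have : [set` F]%classic x by rewrite -FE.
by exists [` xF]%fset.
Qed.

Lemma surj_finite (T : finType) (X : choiceType) (g : T -> X) :
  (forall x, exists t, x = g t) -> finite_set [set: X].
Proof.
move=> gP; apply: (sub_finite_set _ (finite_image g (@finite_finset _ setT))).
by move=> x _; have [t ->] := gP x; exists t.
Qed.

Section ModuleQuotient.
Variables (R : nzRingType) (V : lmodType R) (I : submodClosed V).

(* {ideal_quot _} expects closure under opposite, which submodClosed does not *)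
(* provide as such.                                                           *)
Definition submod_pred : {pred V} := I.

Lemma submod_pred_zmod : zmod_closed submod_pred.
Proof. by split=> [|x y xI yI]; rewrite ?rpred0 // -scaleN1r rpredD ?rpredZ. Qed.

HB.instance Definition _ :=
  GRing.isZmodClosed.Build V submod_pred submod_pred_zmod.

Definition modquot := {ideal_quot submod_pred}.

HB.instance Definition _ := GRing.Zmodule.on modquot.

Definition modquot_pi (x : V) : modquot := \pi_{ideal_quot submod_pred} x.

Lemma modquot_piP x y : reflect (modquot_pi x = modquot_pi y) (x - y \in I).
Proof.
rewrite -[_ \in I]/(x - y \in submod_pred) Quotient.idealrBE.
exact: eqP.
Qed.

Lemma modquot_piD : {morph modquot_pi : x y / x + y}.
Proof. exact: (raddfD (\pi_{ideal_quot submod_pred})). Qed.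

Lemma modquotW (x : modquot) : exists y, x = modquot_pi y.
Proof. by exists (repr x); rewrite /modquot_pi reprK. Qed.

Definition modquot_scale (r : R) (x : modquot) : modquot :=
  modquot_pi (r *: repr x).

Lemma modquot_piZ r x : modquot_scale r (modquot_pi x) = modquot_pi (r *: x).
Proof.
apply/modquot_piP; rewrite -scalerBr rpredZ //.
by apply/modquot_piP; rewrite /modquot_pi reprK.
Qed.

Lemma modquot_scaleA r1 r2 x :
  modquot_scale r1 (modquot_scale r2 x) = modquot_scale (r1 * r2) x.
Proof. by have [y ->] := modquotW x; rewrite !modquot_piZ scalerA. Qed.

Lemma modquot_scale1 : left_id 1 modquot_scale.
Proof. by move=> x; have [y ->] := modquotW x; rewrite modquot_piZ scale1r. Qed.

Lemma modquot_scaleDr : right_distributive modquot_scale +%R.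
Proof.
move=> r x y; have [u ->] := modquotW x; have [v ->] := modquotW y.
by rewrite -modquot_piD !modquot_piZ scalerDr modquot_piD.
Qed.

Lemma modquot_scaleDl x : {morph modquot_scale^~ x : r1 r2 / r1 + r2}.
Proof.
move=> r1 r2; have [u ->] := modquotW x.
by rewrite !modquot_piZ scalerDl modquot_piD.
Qed.

HB.instance Definition _ := GRing.Zmodule_isLmodule.Build R modquot
  modquot_scaleA modquot_scale1 modquot_scaleDr modquot_scaleDl.
End ModuleQuotient.

(* The exterior algebra of R^s is free on the e_A = e_{a_1} /\ ... /\ e_{a_i}, *)
(* for A = {a_1 < ... < a_i} a set of indices.  For an R-module M, the module *)
(* underlying K(f) (x)_R M is therefore that of the families of elements of M *)
(* indexed by the sets of indices; its part of degree i consists of the       *)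
(* families supported on the sets of cardinal i.  K(f) is the case M = R^o.   *)
Section Koszul.
Variables (R : comNzRingType) (s : nat) (f : 'I_s -> R) (M : lmodType R).

Definition koszul := {ffun {set 'I_s} -> M}.

HB.instance Definition _ := GRing.Lmodule.on koszul.

(* e_A (x) m *)
Definition wedge (A : {set 'I_s}) (m : M) : koszul :=
  [ffun B => if B == A then m else 0].

(* The sign of the k-th term is (-1)^(k-1), and k - 1 is the number of        *)
(* elements of A below a = a_k.  This vanishes in degree 0, so that           *)
(* koszul_cycle 0 below is all of K_0.                                        *)
Definition koszul_diff (c : koszul) : koszul :=
  \sum_(A : {set 'I_s}) \sum_(a in A)
     wedge (A :\ a) (((-1) ^+ #|[set b in A | (b < a)%N]| * f a) *: c A).

Definition koszul_degree (i : nat) : {pred koszul} :=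
  fun c => [forall A : {set 'I_s}, (c A != 0) ==> (#|A| == i)].

Definition koszul_cycle (i : nat) : {pred koszul} :=
  fun c => (c \in koszul_degree i) && (koszul_diff c == 0).

Lemma wedge_linear A (r : R) (x y : M) :
  wedge A (r *: x + y) = r *: wedge A x + wedge A y.
Proof.
apply/ffunP => B; rewrite !ffunE; case: ifP => // _.
by rewrite scaler0 addr0.
Qed.

Lemma koszul_diff_linear : linear koszul_diff.
Proof.
move=> r c d; rewrite /koszul_diff scaler_sumr -big_split /=.
apply: eq_bigr => A _; rewrite scaler_sumr -big_split /=.
apply: eq_bigr => a _; rewrite -wedge_linear !ffunE scalerDr !scalerA.
by rewrite [r * _]mulrC.
Qed.

HB.instance Definition _ :=
  GRing.isLinear.Build R koszul koszul _ koszul_diff koszul_diff_linear.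

Lemma koszul_diff_wedge (A : {set 'I_s}) (m : M) :
  koszul_diff (wedge A m) =
  \sum_(a in A)
     wedge (A :\ a) (((-1) ^+ #|[set b in A | (b < a)%N]| * f a) *: m).
Proof.
rewrite {1}/koszul_diff (bigD1 A) //= [X in _ + X]big1 ?addr0.
  by apply: eq_bigr => a _; rewrite ffunE eqxx.
move=> B /negPf BA; rewrite big1 // => a _.
by apply/ffunP => C; rewrite !ffunE BA scaler0 if_same.
Qed.

Lemma koszulE (c : koszul) : c = \sum_(A : {set 'I_s}) wedge A (c A).
Proof.
apply/ffunP => B; rewrite sum_ffunE (bigD1 B) //= ffunE eqxx big1 ?addr0 //.
by move=> A /negPf AB; rewrite ffunE eq_sym AB.
Qed.

Lemma koszul_diff_sum I (r : seq I) (P : pred I) (F : I -> koszul) :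
  koszul_diff (\sum_(i <- r | P i) F i) = \sum_(i <- r | P i) koszul_diff (F i).
Proof. exact: (linear_sum (koszul_diff)). Qed.

Lemma koszul_diffK (c : koszul) : koszul_diff (koszul_diff c) = 0.
Proof.
have -> : koszul_diff c = \sum_A koszul_diff (wedge A (c A)).
  by rewrite {1}[c]koszulE koszul_diff_sum.
rewrite koszul_diff_sum big1 // => A _.
rewrite koszul_diff_wedge koszul_diff_sum.
under eq_bigr => a _ do rewrite koszul_diff_wedge.
rewrite (eq_bigr (fun a => \sum_(b in A | b != a) wedge (A :\ a :\ b)
    (((-1) ^+ #|[set x in A :\ a | (x < b)%N]| * f b) *:
    (((-1) ^+ #|[set x in A | (x < a)%N]| * f a) *: c A)))); last first.
  by move=> a _; apply: eq_bigl => b; rewrite !inE andbC.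
pose F a b := wedge (A :\ a :\ b)
    (((-1) ^+ #|[set x in A :\ a | (x < b)%N]| * f b) *:
    (((-1) ^+ #|[set x in A | (x < a)%N]| * f a) *: c A)).
have FE (a b : 'I_s) : b \in A -> (b < a)%N -> F a b = - F b a.
  move=> bA ba; rewrite /F -scaleN1r.
  have -> : A :\ b :\ a = A :\ a :\ b by rewrite !finset.setDDl finset.setUC.
  apply/ffunP => B; rewrite !ffunE; case: ifP => _; last by rewrite scaler0.
  have -> : [set x in A :\ a | (x < b)%N] = [set x in A | (x < b)%N].
    apply/setP => x; rewrite !inE; case: eqP => // ->.
    by rewrite ltnNge (ltnW ba) /= andbF.
  have -> : #|[set x in A | (x < a)%N]| = #|[set x in A :\ b | (x < a)%N]|.+1.
    rewrite (cardsD1 b) !inE bA ba add1n; congr (_.+1).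
    by apply: eq_card => x; rewrite !inE andbA.
  by rewrite !scalerA exprS; congr (_ *: _); rewrite -!mulrA; ring.
rewrite (eq_bigr (fun a : 'I_s => \sum_(b in A | (a < b)%N) F a b +
    \sum_(b in A | (b < a)%N) F a b)); last first.
  move=> a _; rewrite (bigID (fun b : 'I_s => (a < b)%N)) /=; congr (_ + _).
    by apply: eq_bigl => b; rewrite -andbA -val_eqE /=; case: ltngtP.
  by apply: eq_bigl => b; rewrite -andbA -val_eqE /=; case: ltngtP.
rewrite big_split /= [X in _ + X](eq_bigr (fun a : 'I_s =>
   \sum_(b in A | (b < a)%N) - F b a)); last first.
  by move=> a aA; apply: eq_bigr => b /andP[bA ba]; rewrite FE.
rewrite [X in _ + X](exchange_big_dep (mem A)) /=; last by move=> ? ? _ /andP[].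
rewrite -big_split /= big1 // => a aA.
rewrite sumrN; apply/eqP; rewrite subr_eq0; apply/eqP; apply: eq_bigl => b.
by rewrite aA.
Qed.

Lemma koszul_degreeP (i : nat) (c : koszul) :
  reflect (forall A : {set 'I_s}, #|A| != i -> c A = 0) (c \in koszul_degree i).
Proof.
apply: (iffP forallP) => h A.
  by move=> Ai; apply/eqP; have := h A; rewrite (negPf Ai) implybF negbK.
by apply/implyP; apply: contraR => /h ->.
Qed.

Lemma koszul_degree_submod i : submod_closed (koszul_degree i).
Proof.
split; first by apply/koszul_degreeP => A _; rewrite ffunE.
move=> r c d /koszul_degreeP hc /koszul_degreeP hd; apply/koszul_degreeP => A Ai.
by rewrite !ffunE hc // hd // scaler0 addr0.
Qed.

HB.instance Definition _ i := GRing.isSubmodClosed.Build R koszul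
  (koszul_degree i) (koszul_degree_submod i).

Lemma koszul_cycle_submod i : submod_closed (koszul_cycle i).
Proof.
split; first by rewrite unfold_in rpred0 linear0 eqxx.
move=> r c d /andP[ci /eqP dc] /andP[di /eqP dd].
rewrite unfold_in rpredD ?rpredZ //=; apply/eqP.
by rewrite [LHS]koszul_diff_linear dc dd scaler0 addr0.
Qed.

HB.instance Definition _ i := GRing.isSubmodClosed.Build R koszul
  (koszul_cycle i) (koszul_cycle_submod i).

Record cycles (i : nat) :=
  Cycle { cycle_val : koszul; cycleP : cycle_val \in koszul_cycle i }.

HB.instance Definition _ i := [isSub for @cycle_val i].
HB.instance Definition _ i := [Choice of cycles i by <:].
HB.instance Definition _ i := [SubChoice_isSubLmodule of cycles i by <:].

Definition koszul_boundary (i : nat) : {pred cycles i} := fun z =>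
  `[< exists2 c, c \in koszul_degree i.+1 & val z = koszul_diff c >].

Lemma koszul_boundary_submod i : submod_closed (@koszul_boundary i).
Proof.
split; first by apply/asboolP; exists 0; rewrite ?rpred0 // linear0 raddf0.
move=> r x y /asboolP[c ci dc] /asboolP[d di dd]; apply/asboolP.
exists (r *: c + d); first by rewrite rpredD ?rpredZ.
by rewrite [RHS]koszul_diff_linear -dc -dd linearP.
Qed.

HB.instance Definition _ i := GRing.isSubmodClosed.Build R (cycles i)
  (@koszul_boundary i) (@koszul_boundary_submod i).

Definition koszul_homology (i : nat) := modquot (@koszul_boundary i).

HB.instance Definition _ i := GRing.Lmodule.on (koszul_homology i).
End Koszul.

(* Hom_A(V, A) for a module V over a commutative A-algebra R, where A acts on *)
(* V through a |-> a%:A.  It is an R-module for (r * lam) v = lam (r *: v).   *)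
Section Dual.
Variables (A : comNzRingType) (R : comAlgType A) (V : lmodType R).

Definition dual_pred : {pred V -> A} := fun lam =>
  `[< forall (a : A) (u v : V), lam (a%:A *: u + v) = a * lam u + lam v >].

Lemma dual_zmod : zmod_closed dual_pred.
Proof.
split; first by apply/asboolP => a u v; rewrite mulr0 addr0.
move=> x y /asboolP hx /asboolP hy; apply/asboolP => a u v.
rewrite -[LHS]/(x _ - y _) hx hy.
by rewrite -[RHS]/(a * (x u - y u) + (x v - y v)) mulrBr opprD addrACA.
Qed.

HB.instance Definition _ := GRing.isZmodClosed.Build (V -> A) dual_pred dual_zmod.

Record dual := Dual { dual_val :> V -> A; dualP : dual_val \in dual_pred }.

HB.instance Definition _ := [isSub for dual_val].
HB.instance Definition _ := [Choice of dual by <:].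
HB.instance Definition _ := [SubChoice_isSubZmodule of dual by <:].

Lemma dual_scale_subproof (r : R) (lam : dual) :
  (fun v => lam (r *: v)) \in dual_pred.
Proof.
apply/asboolP => a u v; have /asboolP h := dualP lam.
by rewrite scalerDr scalerA mulrC -scalerA h.
Qed.

Definition dual_scale (r : R) (lam : dual) : dual :=
  Dual (dual_scale_subproof r lam).

Lemma dual_scaleA r1 r2 lam :
  dual_scale r1 (dual_scale r2 lam) = dual_scale (r1 * r2) lam.
Proof. by apply/val_inj/funext => v /=; rewrite scalerA mulrC. Qed.

Lemma dual_scale1 : left_id 1 dual_scale.
Proof. by move=> lam; apply/val_inj/funext => v /=; rewrite scale1r. Qed.

Lemma dual_scaleDr : right_distributive dual_scale +%R.
Proof. by move=> r lam mu; apply/val_inj/funext. Qed.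

Lemma dual_scaleDl lam : {morph dual_scale^~ lam : r1 r2 / r1 + r2}.
Proof.
move=> r1 r2; apply/val_inj/funext => v /=.
have /asboolP h := dualP lam.
by rewrite scalerDl; have := h 1 (r1 *: v) (r2 *: v); rewrite scale1r scale1r mul1r.
Qed.

HB.instance Definition _ := GRing.Zmodule_isLmodule.Build R dual
  dual_scaleA dual_scale1 dual_scaleDr dual_scaleDl.
End Dual.

Definition lmod_isomorphic (R : nzRingType) (U V : lmodType R) : Prop :=
  exists phi : {linear U -> V}, bijective phi.

Definition torus_homology (D : nat) (A : comNzRingType) (s : nat)
    (f : 'I_s -> laurent D A) (L : 'I_D -> nat) (j : nat) :=
  koszul_homology f (torus_ring A L) j.

HB.instance Definition _ (D : nat) (A : comNzRingType) (s : nat)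
    (f : 'I_s -> laurent D A) (L : 'I_D -> nat) (j : nat) :=
  GRing.Lmodule.on (torus_homology f L j).

Section HomologyFinite.
Variables (D s : nat) (A : finComNzRingType) (f : 'I_s -> laurent D A).
Variable (L : 'I_D -> nat).

Lemma torus_homology_finite j : (forall i, (0 < L i)%N) ->
  finite_set [set: torus_homology f L j].
Proof.
move=> /(@torus_ring_finite D A L) /finite_surj[T [g gP]].
have Kfin : finite_set [set: koszul s (torus_ring A L)].
  apply: (@surj_finite {ffun {set 'I_s} -> T} _ (fun h => [ffun B => g (h B)])).
  move=> c; have [h hP] := choice gP.
  by exists [ffun B => h (c B)]; apply/ffunP => B; rewrite !ffunE -hP.
have Zfin : finite_set [set: cycles f (torus_ring A L) j].
  rewrite -(eq_finite_set (inj_card_eq (f := val) _)); last first.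
    by move=> x y _ _; apply: val_inj.
  exact: sub_finite_set Kfin.
apply: (sub_finite_set _ (finite_image (@modquot_pi _ _ _) Zfin)) => x _.
by have [z ->] := modquotW x; exists z.
Qed.
End HomologyFinite.

Lemma p_group_card (V : zmodType) (p m : nat) : prime p ->
  (forall v : V, v *+ p ^ m = 0) -> finite_set [set: V] ->
  exists k, #|` fset_set [set: V] | = (p ^ k)%N.
Proof.
move=> p_pr pV /fset_setK; set F := fset_set _ => FE.
have VF v : v \in F by have : [set` F]%classic v by rewrite FE.
have VFK : cancel (fun v => [` VF v]%fset) val by [].
have Fax : Finite.axiom (enum_fset F).
  by move=> v; rewrite count_uniq_mem ?fset_uniq // VF.
pose fV := HB.pack_for finZmodType V (CanIsCountable VFK) (isFinite.Build V Fax).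
pose G := [set: fV]%G.
have -> : #|` F| = #|G|.
  rewrite -[LHS](@card_uniqP fV _ (fset_uniq F)) cardsT.
  by apply: eq_card => v; rewrite inE; apply: VF.
have : p.-nat #|G|.
  apply/pnatP => // q q_pr /(Cauchy q_pr)[x _ xq].
  have : (q %| p ^ m)%N by rewrite -xq order_dvdn FinRing.zmodXgE pV.
  by rewrite Euclid_dvdX // dvdn_prime2 // => /andP[].
by move=> /p_natP[k ->]; exists k.
Qed.

Section LogCard.
Variables (p m D s : nat) (f : 'I_s -> laurent D 'Z_(p ^ m)).
Variables (L : 'I_D -> nat) (j : nat).

(* k_j(L) = log_p |H_j|; the cardinal is that of a finite set, and a power of *)
(* p, by expn_torus_log_card below.                                           *)
Definition torus_log_card : nat :=
  logn p #|` fset_set [set: torus_homology f L j] |.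

Lemma expn_torus_log_card : prime p -> (0 < m)%N -> (forall i, 0 < L i)%N ->
  finite_set [set: torus_homology f L j] /\
  (p ^ torus_log_card)%N = #|` fset_set [set: torus_homology f L j] |.
Proof.
move=> p_pr m_gt0 L_gt0.
have Hfin : finite_set [set: torus_homology f L j].
  exact: torus_homology_finite.
split=> //; rewrite /torus_log_card.
have [|k ->] := p_group_card p_pr _ Hfin (m := m); last by rewrite pfactorK.
move=> v; rewrite -scaler_nat.
have pm_gt1 : (1 < p ^ m)%N by rewrite -(exp1n m) ltn_exp2r // prime_gt1.
have pm0 : (p ^ m)%:R = 0 :> 'Z_(p ^ m) by rewrite pchar_Zp.
have -> : (p ^ m)%:R = ((p ^ m)%:R : 'Z_(p ^ m))%:A :> laurent D 'Z_(p ^ m).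
  by rewrite scaler_nat.
by rewrite pm0 !scale0r.
Qed.
End LogCard.

Arguments torus_log_card p {m D s} f L j.

(* Main.v *)
(* Write A = Z/p^m.  The torus ring R_L is the group algebra over A of a finite
   abelian group, so x, y |-> tau(x y), with tau the coefficient at 1, is a
   perfect form on it.  The pairing <c, d> = sum_B sgn(B) tau(c_B d_(~B)) of
   K_j with K_(s-j) is then perfect, and for a suitable choice of sgn the
   Koszul differential is its own adjoint.  Since A is an injective A-module,
   the pairing induced on H_j x H_(s-j) is perfect as well, which is the
   isomorphism.  It also yields |H_(s-j)| <= |Hom(H_j, A)| <= |H_j|, and the
   equality of cardinals by exchanging j and s - j. *)

Require Import Defs.
From HB Require Import structures.
From mathcomp Require Import all_boot all_order all_algebra algC cyclotomic.
From mathcomp Require Import finmap monalg ring_quotient zify.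
From mathcomp Require Import boolp classical_sets cardinality.

Set Implicit Arguments.
Unset Strict Implicit.
Unset Printing Implicit Defensive.

Import GRing.Theory Num.Theory.

Local Open Scope ring_scope.

(** * Duality over Z/n *)

Section UnbundledAdditive.
Variables (U V : zmodType) (h : U -> V).
Hypothesis hD : {morph h : x y / x + y}.

Lemma morphD0 : h 0 = 0.
Proof. by apply: (addIr (h 0)); rewrite -hD !add0r. Qed.

Lemma morphDN : {morph h : x / - x}.
Proof.
by move=> x; apply: (addIr (h x)); rewrite -hD !addNr morphD0.
Qed.

Lemma morphDB : {morph h : x y / x - y}.
Proof. by move=> x y; rewrite hD morphDN. Qed.

Lemma morphDMn k : {morph h : x / x *+ k}.
Proof. by move=> x; elim: k => [|k IHk]; rewrite ?morphD0 // !mulrS hD IHk. Qed.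

Lemma morphD_sum I (r : seq I) (P : pred I) (F : I -> U) :
  h (\sum_(i <- r | P i) F i) = \sum_(i <- r | P i) h (F i).
Proof. exact: (big_morph h hD morphD0). Qed.
End UnbundledAdditive.

(** * Injectivity of Z/n on groups killed by [n] *)

Section TorsionExtension.
Variables (n : nat) (V : zmodType).
Hypotheses (n_gt1 : (1 < n)%N) (V_torsion : forall v : V, v *+ n = 0).

(** In a group killed by [n], closure under sums gives closure under opposites, since [- v] is
    [v *+ n.-1]. *)
Definition add_closed (W : zmodType) (N : W -> Prop) :=
  N 0 /\ forall u v, N u -> N v -> N (u + v).

Lemma add_closedMn (W : zmodType) (N : W -> Prop) v k :
  add_closed N -> N v -> N (v *+ k).
Proof.
by move=> [N0 ND] Nv; elim: k => [|k IHk]; rewrite ?mulr0n // mulrS; apply: ND.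
Qed.

Lemma order_modulo (N : V -> Prop) (x : V) : add_closed N ->
  exists o, [/\ (0 < o)%N, (o %| n)%N & forall i, N (x *+ i) -> (o %| i)%N] /\
    N (x *+ o).
Proof.
move=> Nadd; have [N0 ND] := Nadd.
have exP : exists i, (0 < i)%N && `[< N (x *+ i) >].
  by exists n; rewrite (ltnW n_gt1) /=; apply/asboolP; rewrite V_torsion.
case: (ex_minnP exP) => o /andP[o_gt0 /asboolP No] omin; exists o.
have dvd_o i : N (x *+ i) -> (o %| i)%N.
  move=> Ni; rewrite /dvdn; case: posnP => // r_gt0.
  suff Nr : N (x *+ (i %% o)).
    have := omin (i %% o)%N; rewrite r_gt0 (asboolT Nr) leqNgt ltn_pmod //.
    by move=> /(_ isT).
  have -> : x *+ (i %% o) = x *+ i + x *+ o *+ (i %/ o) *+ n.-1.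
    rewrite {2}(divn_eq i o) mulrnDr mulnC mulrnA addrAC -mulrS.
    by rewrite prednK ?(ltnW n_gt1) // V_torsion add0r.
  by apply: ND => //; do 2 apply: add_closedMn => //.
by split=> //; split=> //; apply: dvd_o; rewrite V_torsion.
Qed.

Lemma Zp_torsion (a : 'Z_n) : a *+ n = 0.
Proof. by rewrite -mulr_natr pchar_Zp // mulr0. Qed.

Lemma Zp_natr_eq0 k : (k%:R == 0 :> 'Z_n) = (n %| k)%N.
Proof. by rewrite -val_eqE /= val_Zp_nat // /dvdn. Qed.

(* A partial additive map is encoded by its graph. *)
Definition partial_additive (G : V * 'Z_n -> Prop) :=
  add_closed G /\ forall a, G (0, a) -> a = 0.

(** With [o] the order of [x] modulo the domain of [G] and [b] the value at [x *+ o], the point [x]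
    may be sent to any [a] such that [b = a *+ o]. *)
Lemma partial_additive_extend1 G x : partial_additive G ->
  exists2 G' : V * 'Z_n -> Prop, partial_additive G' &
    (forall w, G w -> G' w) /\ exists a, G' (x, a).
Proof.
move=> [Gadd Gfun]; have [G0 GD] := Gadd.
have domadd : add_closed (fun v => exists a, G (v, a)).
  split=> [|u v [a Ga] [b Gb]]; first by exists 0.
  by exists (a + b); apply: GD Ga Gb.
have [o [[o_gt0 o_n o_dvd] [b Gb]]] := order_modulo x domadd.
have [a ba] : exists a, b = a *+ o.
  have /dvdnP[q nE] := o_n.
  have q_gt0 : (0 < q)%N by move: n_gt1; rewrite nE; case: (q).
  (* [b *+ q] is the value at [x *+ n = 0]; in Z/n the elements killed by [q = n / o] are the
     multiples of [o]. *)
  have : b *+ q = 0.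
    apply: Gfun; have := add_closedMn q Gadd Gb.
    by rewrite pairMnE /= -mulrnA mulnC -nE V_torsion.
  rewrite -[b]natr_Zp -mulrnA => /eqP; rewrite Zp_natr_eq0 {1}nE mulnC.
  rewrite dvdn_pmul2r // => /dvdnP[k ->]; exists k%:R.
  by rewrite natrM mulr_natr.
exists (fun w => exists i w', G w' /\ w = w' + (x, a) *+ i).
  split; first split.
  - by exists 0, 0; rewrite addr0.
  - move=> u v [i [u' [Gu ->]]] [k [v' [Gv ->]]]; exists (i + k)%N, (u' + v').
    by split; [apply: GD | rewrite mulrnDr addrACA].
  (* If [u + x *+ i = 0], then [x *+ i] is in the domain, so [i = k * o], and
     [d + a *+ i = d + b *+ k] is a value of [G] at 0. *)
  - move=> c [i [[u d] [Gu]]]; rewrite pairMnE => -[/= uE ->].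
    have xi : x *+ i = u *+ n.-1.
      by apply: (addrI u); rewrite -uE -mulrS prednK ?V_torsion // ltnW.
    have /o_dvd /dvdnP[k iE] : exists e, G (x *+ i, e).
      exists (d *+ n.-1); rewrite xi.
      by have := add_closedMn n.-1 Gadd Gu; rewrite pairMnE.
    apply: Gfun; have := GD _ _ Gu (add_closedMn k Gadd Gb).
    by rewrite pairMnE ba -!mulrnA [(o * k)%N]mulnC -iE /= uE.
split; first by move=> w Gw; exists 0, w; rewrite addr0.
by exists a, 1, 0; rewrite mulr1n add0r.
Qed.

(* Z/n is an injective module over itself. *)
Lemma additive_extension G : finite_set [set: V] -> partial_additive G ->
  exists2 lam : V -> 'Z_n, {morph lam : x y / x + y} &
    forall v a, G (v, a) -> lam v = a.
Proof.
move=> /finite_fsetP[F FE] Gp.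
(* As [V] is finite, extending along its enumeration reaches a total graph. *)
have [G' [[G'0 G'D] G'fun] [GG' G'F]] : exists2 G' : V * 'Z_n -> Prop,
    partial_additive G' &
    (forall w, G w -> G' w) /\ forall x, x \in enum_fset F -> exists a, G' (x, a).
  elim: (enum_fset F) => [|x r [G1 G1p [GG1 G1r]]]; first by exists G.
  have [G2 G2p [G12 G2x]] := partial_additive_extend1 x G1p.
  exists G2 => //; split=> [w /GG1 /G12 //|y].
  rewrite inE => /predU1P[-> //|/G1r[a /G12]]; by exists a.
have G'n v a : G' (v, a) -> G' (- v, - a).
  move=> Gva; have := add_closedMn n.-1 (conj G'0 G'D) Gva; rewrite pairMnE.
  have NE (W : zmodType) (y : W) : y *+ n = 0 -> y *+ n.-1 = - y.
    by move=> yn; apply: (addrI y); rewrite -mulrS prednK ?subrr // ltnW.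
  by rewrite !NE ?V_torsion ?Zp_torsion.
have G'u v a c : G' (v, a) -> G' (v, c) -> a = c.
  move=> Ga /G'n Gc; apply/eqP; rewrite -subr_eq0; apply/eqP/G'fun.
  by have := G'D _ _ Ga Gc; rewrite -[X in G' X]/(v - v, a - c) subrr.
have G'tot v : exists a, G' (v, a).
  by apply: G'F; have : [set` F]%classic v by rewrite -FE.
have [lam lamP] := choice G'tot; exists lam.
  by move=> x y; apply: G'u (lamP _) (G'D _ _ (lamP x) (lamP y)).
by move=> v a /GG' /(G'u _ _ _ (lamP v)).
Qed.

(** With [o] the order of [w] modulo [N] and [q = n / o], sending [N] to 0 and [w] to [q] is
    consistent because [q * o] vanishes in Z/n. As [w] is outside [N], [o] is not 1 and [q] is
    nonzero in Z/n. *)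
Lemma additive_separation (N : V -> Prop) w : finite_set [set: V] ->
    add_closed N -> ~ N w ->
  exists2 lam : V -> 'Z_n, {morph lam : x y / x + y} &
    (forall v, N v -> lam v = 0) /\ lam w <> 0.
Proof.
move=> Vfin Nadd Nw; have [N0 ND] := Nadd.
have [o [[o_gt0 /dvdnP[q nE] o_dvd] No]] := order_modulo w Nadd.
have q_gt0 : (0 < q)%N by move: n_gt1; rewrite nE; case: (q).
have o_neq1 : o != 1%N by apply/eqP => o1; move: No; rewrite o1.
pose G (z : V * 'Z_n) := exists i u, N u /\ z = (u + w *+ i, (q * i)%:R).
have [|lam lamD lamG] := @additive_extension G Vfin.
  split; first split.
  - by exists 0, 0; rewrite muln0 addr0.
  - move=> _ _ [i [u [Nu ->]]] [k [v [Nv ->]]]; exists (i + k)%N, (u + v).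
    split; first exact: ND.
    by rewrite mulrnDr mulnDr natrD addrACA.
  - move=> a [i [u [Nu [uE ->]]]].
    have wi : w *+ i = u *+ n.-1.
      by apply: (addrI u); rewrite -uE -mulrS prednK ?V_torsion // ltnW.
    have /o_dvd oi : N (w *+ i) by rewrite wi; apply: add_closedMn.
    by apply/eqP; rewrite Zp_natr_eq0 {1}nE dvdn_pmul2l.
exists lam => //; split=> [v Nv|].
  by apply: lamG; exists 0, v; rewrite muln0 addr0.
have -> : lam w = q%:R by apply: lamG; exists 1, 0; rewrite muln1 mulr1n add0r.
move/eqP; rewrite Zp_natr_eq0 {1}nE -{2}[q]muln1 dvdn_pmul2l // dvdn1.
by rewrite (negPf o_neq1).
Qed.
End TorsionExtension.

(* A family of distinct characters is orthogonal, so its size is the rank of  *)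
(* its matrix of values.                                                      *)
Lemma leq_card_additive (n : nat) (V : zmodType) (W : choiceType)
    (Phi : W -> V -> 'Z_n) :
    finite_set [set: V] -> finite_set [set: W] -> injective Phi ->
    (forall w, {morph Phi w : x y / x + y}) ->
  (#|` fset_set [set: W]| <= #|` fset_set [set: V]|)%N.
Proof.
move=> Vfin Wfin Phi_inj PhiD.
set FW := fset_set [set: W]; set FV := fset_set [set: V].
have FVin v : v \in FV by rewrite in_fset_set // inE.
(* The order [(Zp_trunc n).+2] of [z] is the cardinal of ['Z_n] for every [n], so powers of [z] turn
   additive maps into characters. *)
have [z z_prim] := C_prim_root_exists (ltn0Sn (Zp_trunc n).+1).
have z_neq0 : z != 0.
  apply/eqP => z0; have /eqP := prim_expr_order z_prim.
  by rewrite z0 expr0n eq_sym oner_eq0.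
pose chi (w : W) (v : V) := z ^+ Phi w v.
have chi_neq0 w v : chi w v != 0 by rewrite expf_neq0.
have chiD w u v : chi w (u + v) = chi w u * chi w v.
  by rewrite /chi PhiD /= (prim_expr_mod z_prim) exprD.
have ortho w1 w2 : w1 != w2 ->
    \sum_(v : FV) chi w1 (val v) / chi w2 (val v) = 0.
  move=> w12; pose psi v := chi w1 v / chi w2 v.
  have [v0 psi_v0] : exists v0, psi v0 != 1.
    apply: contrapT => psi1; case/eqP: w12; apply/Phi_inj/funext => v.
    apply: contrapT => Pv; apply: psi1; exists v; apply/eqP.
    move=> /(divr1_eq) /eqP; rewrite (eq_prim_root_expr z_prim).
    by rewrite !modn_small ?ltn_ord // => /eqP /val_inj.
  have psiD v : psi (v + v0) = psi v0 * psi v.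
    by rewrite /psi !chiD invfM mulrACA mulrC.
  pose h (v : FV) : FV := FSetSub (FVin (val v + v0)).
  have h_inj : injective h by move=> u v /(congr1 val) /= /addIr /val_inj.
  (* Translation by [v0] permutes the terms and multiplies the sum by [psi v0], which is not 1. *)
  have sumE : \sum_(v : FV) psi (val v) = psi v0 * \sum_(v : FV) psi (val v).
    rewrite [LHS](reindex_inj h_inj) mulr_sumr; apply: eq_bigr => v _.
    exact: psiD.
  move/eqP: sumE; rewrite -subr_eq0 -{1}[X in X - _]mul1r -mulrBl mulf_eq0.
  by rewrite subr_eq0 eq_sym (negPf psi_v0) => /eqP.
(* By orthogonality [Y] is a right inverse of [X], so the rows of [X] are at most as many as its
   columns. *)
pose X := \matrix_(i < #|{: FW}|, j < #|{: FV}|)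
  chi (val (enum_val i)) (val (enum_val j)).
pose Y := \matrix_(j < #|{: FV}|, i < #|{: FW}|)
  ((#|{: FV}|%:R)^-1 / chi (val (enum_val i)) (val (enum_val j))).
have XY : X *m Y = 1%:M.
  apply/matrixP => i1 i2; rewrite !mxE.
  under eq_bigr => j _ do rewrite !mxE mulrCA.
  rewrite -mulr_sumr.
  pose g (v : FV) :=
    chi (val (enum_val i1)) (val v) / chi (val (enum_val i2)) (val v).
  rewrite (_ : \sum_j _ = \sum_v g v); last first.
    by rewrite [RHS](reindex _ (onW_bij _ (@enum_val_bij FV))).
  rewrite /g {g}; case: eqVneq => [->|i12] /=; last first.
    by rewrite ortho ?mulr0 // (inj_eq val_inj) (inj_eq enum_val_inj).
  under eq_bigr => v _ do rewrite divff //.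
  rewrite sumr_const mulVf // pnatr_eq0 -lt0n; apply/card_gt0P.
  by exists (FSetSub (FVin 0)).
rewrite !cardfE -(mxrank1 algC #|{: FW}|) -XY.
exact: leq_trans (mxrankM_maxl _ _) (rank_leq_col _).
Qed.

(** * The trace form of the torus ring *)

Section TorusTrace.
Variables (D : nat) (A : comNzRingType) (L : 'I_D -> nat).
Local Notation K := 'rV[int]_D.
Local Notation R := (laurent D A).
Local Notation T := (torus_ring A L).

Definition in_periods (k : K) := [forall i, ((L i)%:Z %| k ord0 i)%Z].

Lemma in_periodsD (k : K) (i : 'I_D) :
  in_periods (k + delta_mx 0 i *+ L i) = in_periods k.
Proof.
apply: eq_forallb => l; rewrite !mxE mulmxnE !mxE eqxx /=.
case: eqVneq => [->|_]; last by rewrite mul0rn addr0.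
rewrite rpredDr // mulr1n natz; exact: dvdzz.
Qed.

(** The coefficients are summed over the whole period lattice, so that the map descends to the torus
    ring. *)
Definition laurent_trace : R -> A := mmap idfun (fun k => (in_periods k)%:R).

Lemma laurent_traceD : {morph laurent_trace : x y / x + y}.
Proof. exact: mmapD. Qed.

Lemma laurent_traceU c k :
  laurent_trace << c *g k >> = c * (in_periods k)%:R.
Proof. exact: mmapU. Qed.

Lemma laurent_mulU (c1 c2 : A) (k1 k2 : K) :
  (<< c1 *g k1 >> : R) * << c2 *g k2 >> = << c1 * c2 *g k1 + k2 >>.
Proof. exact: lmulUU. Qed.

Lemma lvarX i n : lvar A i ^+ n = << delta_mx 0 i *+ n >> :> R.
Proof.
elim: n => [|n IHn]; first by rewrite mulr0n.
by rewrite exprS IHn [LHS]laurent_mulU mulr1 mulrS.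
Qed.

(** Multiplying by [lvar A i ^+ L i] shifts exponents by a period, which preserves membership in the
    lattice; the two terms of each product cancel. *)
Lemma laurent_trace_ideal g : g \in torus_ideal L -> laurent_trace g = 0.
Proof.
move=> /asboolP[c ->]; rewrite (morphD_sum laurent_traceD) big1 // => i _.
rewrite lvarX (laurentE (c i)) mulr_suml (morphD_sum laurent_traceD).
rewrite big1 // => k _; rewrite mulrBr mulr1 (morphDB laurent_traceD).
rewrite [X in laurent_trace X - _]laurent_mulU.
by rewrite !laurent_traceU in_periodsD mulr1 subrr.
Qed.

Definition torus_trace (x : T) : A := laurent_trace (repr x).

Lemma torus_pi_repr (x : T) : torus_pi L (repr x) = x.
Proof. exact: reprK. Qed.

Lemma torus_trace_pi g : torus_trace (torus_pi L g) = laurent_trace g.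
Proof.
apply/eqP; rewrite -subr_eq0 -(morphDB laurent_traceD); apply/eqP.
apply: laurent_trace_ideal; rewrite Quotient.idealrBE.
by rewrite [X in X == _]torus_pi_repr.
Qed.

Lemma torus_traceD : {morph torus_trace : x y / x + y}.
Proof.
move=> x y; rewrite -(torus_pi_repr x) -(torus_pi_repr y) -torus_piD.
by rewrite !torus_trace_pi laurent_traceD.
Qed.
End TorusTrace.

(** * Perfectness of the trace form over Z/n *)

Section TorusFrobenius.
Variables (D n : nat) (L : 'I_D -> nat).
Local Notation A := 'Z_n.
Local Notation K := 'rV[int]_D.
Local Notation R := (laurent D A).
Local Notation T := (torus_ring A L).
Local Notation mono k := (@torus_mono D A L k).

Lemma torus_mono_in_periods (k : K) : in_periods L k -> mono k = 1.
Proof.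
move=> /forallP kL.
have monoMz (l : K) (z : int) : mono l = 1 -> mono (l *~ z) = 1.
  move=> l1; have mono_nat a : mono (l *+ a) = 1.
    elim: a => [|a IHa]; first by rewrite mulr0n torus_pi_mono0.
    by rewrite mulrS torus_pi_monoD l1 IHa mulr1.
  case: z => a; first exact: mono_nat.
  rewrite NegzE mulrNz -pmulrn -[LHS]mulr1 -(mono_nat a.+1) -torus_pi_monoD.
  by rewrite addNr torus_pi_mono0.
have -> : k = \sum_i (delta_mx 0 i *+ L i) *~ (k ord0 i %/ (L i)%:Z)%Z.
  rewrite [LHS]matrix_sum_delta big_ord1; apply: eq_bigr => i _.
  rewrite pmulrn -mulrzA mulrC divzK // -scaler_int intz.
  by congr (_ *: _).
elim/big_ind: _ => [|k1 k2 k11 k21|i _]; first exact: torus_pi_mono0.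
  by rewrite torus_pi_monoD k11 k21 mulr1.
exact/monoMz/torus_pi_period.
Qed.

(** A scalar of ['Z_n] acts as a repeated sum, so additivity alone yields linearity over ['Z_n]. *)
Lemma torus_pi_mkmalg (c : A) (k : K) :
  torus_pi L (<< c *g k >> : R) = mono k *+ c.
Proof.
rewrite -(morphDMn (@torus_piD _ _ _)); congr torus_pi.
by rewrite -[RHS]monalgUMn natr_Zp.
Qed.

Lemma additive_torusP (lam mu : T -> A) :
    {morph lam : x y / x + y} -> {morph mu : x y / x + y} ->
    (forall k, lam (mono k) = mu (mono k)) -> lam =1 mu.
Proof.
move=> lamD muD lam_mu x; rewrite -(torus_pi_repr x) (laurentE (repr x)).
rewrite (morphD_sum (@torus_piD _ _ _)) (morphD_sum lamD) (morphD_sum muD).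
apply: eq_bigr => k _.
by rewrite torus_pi_mkmalg (morphDMn lamD) (morphDMn muD) lam_mu.
Qed.

Lemma torus_trace_mono k : torus_trace (mono k) = (in_periods L k)%:R.
Proof. by rewrite torus_trace_pi laurent_traceU mul1r. Qed.

(** The trace detects a monomial outside the lattice: it is 0 there and 1 at the unit. *)
Lemma torus_mono_eq1 k : (mono k == 1) = in_periods L k.
Proof.
apply/eqP/idP => [k1|]; last exact: torus_mono_in_periods.
apply: contraT => /negPf kL; have := torus_trace_mono k.
rewrite k1 -(torus_pi_mono0 A L) torus_trace_mono kL.
have -> : in_periods L 0 by apply/forallP => i; rewrite mxE dvdz0.
by move=> /eqP; rewrite oner_eq0.
Qed.

Lemma torus_mono_eq k l : (mono k == mono l) = in_periods L (k - l).
Proof.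
have moN : mono l * mono (- l) = 1.
  by rewrite -torus_pi_monoD subrr torus_pi_mono0.
rewrite -torus_mono_eq1 torus_pi_monoD; apply/eqP/eqP => [->|kl] //.
by rewrite -[LHS]mulr1 -moN mulrCA kl mulr1.
Qed.

(* The torus ring is the group algebra of the finite group of the monomials,  *)
(* of which the trace reads off the coefficient at 1.                         *)
Lemma torus_trace_perfect (lam : T -> A) :
    (forall i, (0 < L i)%N) -> {morph lam : x y / x + y} ->
  exists t, forall x, lam x = torus_trace (x * t).
Proof.
move=> L_gt0 lamD; pose G := [set mono k | k in setT]%classic.
have Gfin : finite_set G.
  exact: sub_finite_set (torus_ring_finite A L_gt0).
have [e eP] : exists e : T -> K, forall g, g \in fset_set G -> g = mono (e g).
  have/choice[e eP] : forall g : T, exists k, g \in fset_set G -> g = mono k.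
    move=> g; case: (boolP (g \in fset_set G)) => [|_]; last by exists 0.
    by rewrite in_fset_set // inE => -[k _ <-]; exists k.
  by exists e.
(* The witness is the sum of the inverses of the monomials [g] with weights [lam g]; the trace of
   its product with [mono k] retains only the term [g = mono k]. *)
exists (\sum_(g <- fset_set G) mono (- e g) *+ lam g).
apply: additive_torusP => // [x y|k]; first by rewrite mulrDl torus_traceD.
have kG : mono k \in fset_set G by rewrite in_fset_set // inE; exists k.
rewrite mulr_sumr (morphD_sum (@torus_traceD _ _ _)).
rewrite (bigD1_seq (mono k) kG (fset_uniq _)) /=.
have traceE g : g \in fset_set G ->
    torus_trace (mono k * (mono (- e g) *+ lam g)) = (mono k == g)%:R * lam g.
  move=> gG; rewrite mulrnAr (morphDMn (@torus_traceD _ _ _)) -torus_pi_monoD.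
  by rewrite torus_trace_mono -torus_mono_eq -eP // -[LHS]mulr_natr natr_Zp.
rewrite traceE // eqxx mul1r big_seq_cond big1 ?addr0 // => g /andP[gG gk].
by rewrite traceE // eq_sym (negPf gk) mul0r.
Qed.
End TorusFrobenius.

(** * Koszul complexes *)

Section KoszulCoordinates.
Variables (R : comNzRingType) (s : nat) (f : 'I_s -> R) (M : lmodType R).
Local Notation K := (koszul s M).
Implicit Types (c d : K) (A B : {set 'I_s}).

Definition below A (a : 'I_s) : nat := #|[set b in A | (b < a)%N]|.

(** Only the sets [a |: B] with [a] outside [B] contribute at [B]; the sign can be counted in [B]
    because [a] is not below itself. *)
Lemma koszul_diffE c B :
  koszul_diff f c B =
  \sum_(a | a \notin B) ((-1) ^+ below B a * f a) *: c (a |: B).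
Proof.
rewrite /koszul_diff sum_ffunE; under eq_bigr => A _ do rewrite sum_ffunE.
rewrite (exchange_big_dep xpredT) //= [RHS]big_mkcond /=; apply: eq_bigr => a _.
case: ifPn => [aB|]; last first.
  rewrite negbK => aB; rewrite big1 // => A aA; rewrite ffunE ifN //.
  by apply: contraL aB => /eqP->; rewrite !inE eqxx.
rewrite (bigD1 (a |: B)) /=; last by rewrite setU11.
rewrite ffunE setU1K // eqxx big1 ?addr0 => [|A /andP[aA AB]]; last first.
  by rewrite ffunE ifN //; apply: contraNneq AB => ->; rewrite finset.setD1K.
congr ((_ ^+ _ * _) *: _); apply: eq_card => b; rewrite !inE.
by case: eqP => // ->; rewrite ltnn !andbF.
Qed.

Lemma below_setC A a : (below A a + below (~: A) a)%N = a.
Proof.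
rewrite /below -cardsUI [X in (_ + X)%N](_ : _ = 0%N) ?addn0; last first.
  by apply: eq_card0 => b; rewrite !inE; case: (b \in A); rewrite //= andbF.
rewrite -[RHS]card_ord -[RHS]sum1_card.
rewrite (big_ord_widen s (fun=> 1%N)) ?(ltnW (ltn_ord a)) //.
rewrite sum1dep_card; apply: eq_card => b.
by rewrite !inE -andb_orl orbN.
Qed.

(* Up to a sign independent of A, the sign of e_A /\ e_(~A) with respect to   *)
(* e_1 /\ ... /\ e_s; this normalization makes the differential self-adjoint. *)
Definition koszul_sgn A : R := (-1) ^+ (\sum_(a in A) a)%N.

(** Removing [a] lowers the exponent by [a], which [below_setC] splits into the two counts in
    question. *)
Lemma koszul_sgnD1 A a : a \in A ->
  koszul_sgn (A :\ a) * (-1) ^+ below (A :\ a) a =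
  koszul_sgn A * (-1) ^+ below (~: A) a.
Proof.
move=> aA; rewrite /koszul_sgn (big_setD1 a aA) /=.
have := below_setC (A :\ a) a.
have -> : below (~: (A :\ a)) a = below (~: A) a.
  by apply: eq_card => b; rewrite !inE; case: eqP => // ->; rewrite ltnn !andbF.
set x := below _ _; set y := below _ _; set z := (\sum_(i in _) _)%N => xy.
rewrite -!exprD -signr_odd -[RHS]signr_odd; congr (_ ^+ nat_of_bool _); lia.
Qed.

Lemma koszul_sgn_sqr A : koszul_sgn A * koszul_sgn A = 1.
Proof. by rewrite -expr2 sqrr_sign. Qed.

Lemma koszul_sgnC A :
  koszul_sgn (~: A) = koszul_sgn (finset.setTfor 'I_s) * koszul_sgn A.
Proof.
have -> : koszul_sgn (finset.setTfor 'I_s) = koszul_sgn A * koszul_sgn (~: A).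
  rewrite /koszul_sgn -exprD (bigID (mem A)) /=; congr (_ ^+ (_ + _)).
    by apply: eq_bigl => b; rewrite inE.
  by apply: eq_bigl => b; rewrite !inE.
by rewrite mulrAC koszul_sgn_sqr mul1r.
Qed.

Definition koszul_part (i : nat) c : K :=
  [ffun A : {set 'I_s} => if #|A| == i then c A else 0].

Lemma koszul_part_degree i c : koszul_part i c \in koszul_degree i.
Proof. by apply/koszul_degreeP => A /negPf Ai; rewrite ffunE Ai. Qed.

Lemma koszul_wedge_degree A (m : M) : wedge A m \in koszul_degree #|A|.
Proof.
apply/koszul_degreeP => B BA; rewrite ffunE ifN //.
by apply: contraNneq BA => ->.
Qed.

Lemma koszul_diff_degree i c :
  c \in koszul_degree i.+1 -> koszul_diff f c \in koszul_degree i.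
Proof.
move=> /koszul_degreeP ci; apply/koszul_degreeP => B Bi; rewrite koszul_diffE.
by rewrite big1 // => a aB; rewrite ci ?scaler0 // cardsU1 aB add1n eqSS.
Qed.

Lemma koszul_diff_degree0 c :
  c \in koszul_degree 0 -> koszul_diff f c = 0.
Proof.
move=> /koszul_degreeP ci; apply/ffunP => B; rewrite koszul_diffE ffunE.
by rewrite big1 // => a aB; rewrite ci ?scaler0 // cardsU1 aB add1n.
Qed.
End KoszulCoordinates.

(** * The pairing of complementary degrees *)

Section KoszulPairing.
Variables (R : comNzRingType) (s : nat) (f : 'I_s -> R) (M : lmodType R).
Variables (S : zmodType) (b : M -> M -> S).
Local Notation K := (koszul s M).
Implicit Types (c d : K) (A B : {set 'I_s}).

(** [formZ] makes the action of [R] self-adjoint, which matches the action on the dual without an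
    involution of [R]. *)
Record balanced_form : Prop := BalancedForm {
  formDl : forall y, {morph b^~ y : x1 x2 / x1 + x2};
  formC : forall x y, b x y = b y x;
  formZ : forall r x y, b (r *: x) y = b x (r *: y) }.
Hypothesis bP : balanced_form.

Definition kpair c d : S := \sum_A b (koszul_sgn R A *: c A) (d (~: A)).

Let bDl y : {morph b^~ y : x1 x2 / x1 + x2} := formDl bP y.

Let bDr x : {morph b x : y1 y2 / y1 + y2}.
Proof. by move=> y1 y2; rewrite !(formC bP x) bDl. Qed.

Lemma kpairDl d : {morph kpair^~ d : c1 c2 / c1 + c2}.
Proof.
move=> c1 c2; rewrite /kpair -big_split; apply: eq_bigr => A _ /=.
by rewrite ffunE scalerDr bDl.
Qed.

Lemma kpairDr c : {morph kpair c : d1 d2 / d1 + d2}.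
Proof.
move=> d1 d2; rewrite /kpair -big_split; apply: eq_bigr => A _ /=.
by rewrite ffunE bDr.
Qed.

Lemma kpairZ r c d : kpair (r *: c) d = kpair c (r *: d).
Proof.
by apply: eq_bigr => A _; rewrite !ffunE scalerA mulrC -scalerA (formZ bP).
Qed.

(** Complementing [A] swaps the arguments at the cost of a constant sign, so what holds on one side
    of the pairing transfers to the other. *)
Lemma kpairC c d :
  kpair d c = kpair (koszul_sgn R (finset.setTfor 'I_s) *: c) d.
Proof.
rewrite /kpair (reindex_inj (inv_inj (@finset.setCK _))); apply: eq_bigr => A _.
by rewrite finset.setCK (formZ bP) (formC bP) koszul_sgnC ffunE !scalerA mulrC.
Qed.

(** Both sides are sums over the pairs [a \in A] of terms in [c A] and [d (a |: ~: A)];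
    [koszul_sgnD1] matches their signs. *)
Lemma kpair_diff c d :
  kpair (koszul_diff f c) d = kpair c (koszul_diff f d).
Proof.
pose F a A :=
  b ((koszul_sgn R (A :\ a) * (-1) ^+ below (A :\ a) a * f a) *: c A)
    (d (a |: ~: A)).
transitivity (\sum_(a : 'I_s) \sum_(A : {set 'I_s} | a \in A) F a A); last first.
  rewrite (exchange_big_dep xpredT) //=; apply: eq_bigr => A _.
  rewrite koszul_diffE (morphD_sum (bDr _)) big_mkcond [RHS]big_mkcond /=.
  apply: eq_bigr => a _; rewrite inE negbK; case: ifP => // aA.
  rewrite /F -(formZ bP) scalerA; congr (b (_ *: _) _).
  by rewrite koszul_sgnD1 // -mulrA mulrC.
transitivity (\sum_(B : {set 'I_s}) \sum_(a | a \notin B)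
    b ((koszul_sgn R B * (-1) ^+ below B a * f a) *: c (a |: B)) (d (~: B))).
  rewrite /kpair; apply: eq_bigr => B _.
  rewrite koszul_diffE scaler_sumr (morphD_sum (bDl _)); apply: eq_bigr => a _.
  by rewrite scalerA mulrA.
rewrite (exchange_big_dep xpredT) //=; apply: eq_bigr => a _.
rewrite (reindex_onto (fun A => A :\ a) (fun B => a |: B)) /=; last first.
  by move=> B aB; rewrite setU1K.
apply: eq_big => [A|A].
  rewrite !inE eqxx /=; apply/eqP/idP => [<-|/finset.setD1K //].
  by rewrite setU11.
by move=> /andP[aA /eqP AE]; rewrite /F AE finset.setCD finset.setUC.
Qed.
End KoszulPairing.

Lemma lmod_isomorphic_inv (R : nzRingType) (U V : lmodType R) (h : V -> U) :
    linear h -> injective h -> (forall u, exists v, h v = u) ->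
  lmod_isomorphic U V.
Proof.
move=> h_lin h_inj /choice[g gK].
have hK : cancel h g by move=> v; apply: h_inj; rewrite gK.
have g_lin : linear g by move=> r u v; apply: h_inj; rewrite h_lin !gK.
pose glin := HB.pack_for {linear U -> V} g (GRing.isLinear.Build R U V _ g g_lin).
by exists glin; exists h.
Qed.

(** * Perfect pairings on chains and on homology *)

Section KoszulDuality.
Variables (n : nat) (R : comAlgType 'Z_n) (s : nat) (f : 'I_s -> R).
Variables (M : lmodType R) (b : M -> M -> 'Z_n).
Hypotheses (n_gt1 : (1 < n)%N) (M_finite : finite_set [set: M]).
Hypothesis bP : balanced_form b.
Hypothesis b_perfect : forall lam : M -> 'Z_n, {morph lam : x y / x + y} ->
  exists t, forall x, lam x = b x t.
Local Notation K := (koszul s M).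
Local Notation diff := (koszul_diff f).
Implicit Types (c d : K) (A B : {set 'I_s}).

Lemma alg_scaleE (V : lmodType R) (a : 'Z_n) (v : V) : a%:A *: v = v *+ a.
Proof. by rewrite -{1}[a]natr_Zp [_%:A]scaler_nat scaler_nat. Qed.

Lemma alg_torsion (V : lmodType R) (v : V) : v *+ n = 0.
Proof.
by rewrite -scaler_nat -[n%:R]scaler_nat pchar_Zp // !scale0r.
Qed.

Lemma dualD (V : lmodType R) (lam : dual V) : {morph lam : x y / x + y}.
Proof.
move=> x y; have /asboolP h := dualP lam.
by have := h 1 x y; rewrite !scale1r mul1r.
Qed.

Lemma koszul_finite : finite_set [set: K].
Proof.
have [T [g gP]] := finite_surj M_finite; have [h hP] := choice gP.
apply: (@surj_finite {ffun {set 'I_s} -> T} _ (fun e => [ffun B => g (e B)])).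
by move=> c; exists [ffun B => h (c B)]; apply/ffunP => B; rewrite !ffunE -hP.
Qed.

Lemma wedgeD A : {morph @wedge R s M A : x y / x + y}.
Proof. by move=> x y; rewrite -{1}[x]scale1r wedge_linear scale1r. Qed.

Lemma kpair_perfect (lam : K -> 'Z_n) : {morph lam : x y / x + y} ->
  exists d, forall c, lam c = kpair b c d.
Proof.
move=> lamD.
have /choice[t tP] A : exists t, forall x, lam (wedge A x) = b x t.
  by apply: b_perfect => x y; rewrite wedgeD lamD.
(* The coordinate at [B] represents [lam] on the component [~: B], with a sign that cancels the one
   in [kpair]. *)
exists [ffun B => koszul_sgn R (~: B) *: t (~: B)] => c.
rewrite {1}[c]koszulE (morphD_sum lamD); apply: eq_bigr => A _.
by rewrite ffunE finset.setCK tP (formZ bP) scalerA koszul_sgn_sqr scale1r.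
Qed.

(** An additive map separating a nonzero [d] from 0 is a pairing with some [e], and [kpairC] moves
    [e] to the left. *)
Lemma kpair_nondegenerate d : (forall c, kpair b c d = 0) -> d = 0.
Proof.
move=> d0; apply: contrapT => d_neq0.
have [|lam lamD [_ lam_d]] := additive_separation (N := fun c => c = 0) (w := d)
  n_gt1 (@alg_torsion _) koszul_finite _ d_neq0.
  by split=> // u v -> ->; rewrite addr0.
have [e eP] := kpair_perfect lamD; case: lam_d.
by rewrite eP (kpairC bP) d0.
Qed.

(** Sets of cardinal [i] have complements of cardinal [s - i]; a representing element may thus be
    made homogeneous. *)
Lemma kpair_part i c d : c \in koszul_degree i ->
  kpair b c d = kpair b c (koszul_part (s - i) d).
Proof.
move=> /koszul_degreeP ci; apply: eq_bigr => A _; rewrite ffunE.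
case: (eqVneq #|A| i) => [<-|/ci ->].
  by rewrite cardsCs finset.setCK card_ord eqxx.
by rewrite scaler0 !(morphD0 (fun x y => formDl bP _ x y)).
Qed.

Lemma kpair_degree_neq i k c d :
  c \in koszul_degree i -> d \in koszul_degree k -> (i + k)%N != s ->
  kpair b c d = 0.
Proof.
move=> /koszul_degreeP ci /koszul_degreeP dk ik; rewrite /kpair big1 // => A _.
case: (eqVneq #|A| i) => [Ai|/ci ->].
  rewrite dk; first by rewrite (formC bP) (morphD0 (fun x y => formDl bP _ x y)).
  have := cardsC A; rewrite Ai card_ord => iE.
  by apply: contraNneq ik => Ak; rewrite -Ak iE.
by rewrite scaler0 (morphD0 (fun x y => formDl bP _ x y)).
Qed.

(** By adjointness, orthogonality of [d] to boundaries means orthogonality of [diff d] to all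
    chains, hence [diff d = 0]. *)
Lemma kpair_cycle j d : (j <= s)%N -> d \in koszul_degree (s - j) ->
    (forall c, c \in koszul_degree j.+1 -> kpair b (diff c) d = 0) ->
  d \in koszul_cycle f (s - j).
Proof.
move=> js dj d0; rewrite unfold_in dj; apply/eqP.
apply: kpair_nondegenerate => c; rewrite -(kpair_diff f bP).
rewrite [c]koszulE koszul_diff_sum (morphD_sum (kpairDl bP d)) big1 // => A _.
(* Degree 0 has zero differential, degree [j.+1] is the hypothesis, and in other degrees the
   cardinals do not add up to [s]. *)
have := koszul_wedge_degree A (c A); move: (wedge _ _) #|A| => e [|i] ei.
  by rewrite (koszul_diff_degree0 f ei) (morphD0 (kpairDl bP d)).
have [ij|ij] := eqVneq i j; first by apply: d0; rewrite -ij.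
apply: (kpair_degree_neq (koszul_diff_degree f ei) dj).
by apply: contraNneq ij; lia.
Qed.

Section HomologyPairing.
Variable j : nat.
Hypothesis j_le_s : (j <= s)%N.
Local Notation Z i := (cycles f M i).
Local Notation H i := (koszul_homology f M i).

Lemma cycle_degree i (z : Z i) : val z \in koszul_degree i.
Proof. by have /andP[] := cycleP z. Qed.

Lemma cycle_diff i (z : Z i) : diff (val z) = 0.
Proof. by have /andP[_ /eqP] := cycleP z. Qed.

Lemma homology_piZ i r (z : Z i) :
  r *: (modquot_pi _ z : H i) = modquot_pi _ (r *: z).
Proof. exact: modquot_piZ. Qed.

Lemma homology_eqP i (z z' : Z i) :
  modquot_pi (@koszul_boundary _ _ f M i) z = modquot_pi _ z' <->
  exists2 c, c \in koszul_degree i.+1 & val z - val z' = diff c.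
Proof.
split=> [/modquot_piP /asboolP[c ci zE]|[c ci zE]].
  by exists c => //; rewrite -zE raddfB.
by apply/modquot_piP/asboolP; exists c => //; rewrite raddfB.
Qed.

Definition hclass i (x : H i) : Z i :=
  xget 0 [set z | x = modquot_pi _ z]%classic.

Lemma hclassK i (x : H i) : modquot_pi _ (hclass x) = x.
Proof.
rewrite /hclass; case: xgetP => [z _ <- //|].
by have [z xE] := modquotW x => /(_ z).
Qed.

Definition hpair (x : H j) (y : H (s - j)) : 'Z_n :=
  kpair b (val (hclass x)) (val (hclass y)).

(** Adjointness makes cycles orthogonal to boundaries, so the choice of representatives is
    immaterial. *)
Lemma hpairE z w :
  hpair (modquot_pi _ z) (modquot_pi _ w) = kpair b (val z) (val w).
Proof.
rewrite /hpair; set z' := hclass _; set w' := hclass _.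
have /homology_eqP[c _ /(canRL (subrK _)) ->] := hclassK (modquot_pi _ z).
have /homology_eqP[d _ /(canRL (subrK _)) ->] := hclassK (modquot_pi _ w).
rewrite (kpairDl bP) (kpairDr bP (val z)).
rewrite (kpair_diff f bP) -(kpair_diff f bP (val z)).
rewrite raddfD /= koszul_diffK !cycle_diff addr0 (morphD0 (kpairDr bP _)).
by rewrite (morphD0 (kpairDl bP _)) !add0r.
Qed.

Lemma hpairDl y : {morph hpair^~ y : x1 x2 / x1 + x2}.
Proof.
move=> x1 x2; have [z1 ->] := modquotW x1; have [z2 ->] := modquotW x2.
have [w ->] := modquotW y.
by rewrite -modquot_piD !hpairE raddfD (kpairDl bP).
Qed.

Lemma hpairDr x : {morph hpair x : y1 y2 / y1 + y2}.
Proof.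
move=> y1 y2; have [w1 ->] := modquotW y1; have [w2 ->] := modquotW y2.
have [z ->] := modquotW x.
by rewrite -modquot_piD !hpairE raddfD (kpairDr bP).
Qed.

Lemma hpairZ r x y : hpair (r *: x) y = hpair x (r *: y).
Proof.
have [z ->] := modquotW x; have [w ->] := modquotW y.
by rewrite !homology_piZ !hpairE !linearZ /= (kpairZ bP).
Qed.

Lemma hpair_dual_subproof y : hpair^~ y \in @dual_pred _ _ (H j).
Proof.
apply/asboolP => a u v; rewrite alg_scaleE hpairDl (morphDMn (hpairDl y)).
by rewrite -mulr_natl natr_Zp.
Qed.

Definition hpair_dual y : dual (H j) := Dual (hpair_dual_subproof y).

Lemma hpair_dual_linear : linear hpair_dual.
Proof.
move=> r y1 y2; apply/val_inj/funext => x /=.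
rewrite hpairDr -hpairZ.
exact: erefl.
Qed.

(** Injectivity of Z/n extends [lam], seen on cycles, to all chains, where the pairing represents
    it. *)
Lemma hpair_surjective (lam : dual (H j)) : exists y, hpair_dual y = lam.
Proof.
pose G (w : K * 'Z_n) := exists z : Z j, w = (val z, lam (modquot_pi _ z)).
have [|mu muD muG] := additive_extension n_gt1 (@alg_torsion _) koszul_finite
    (G := G).
  split; first split.
  - exists 0; rewrite [in RHS]raddf0 (morphD0 (@modquot_piD _ _ _)).
    by rewrite (morphD0 (dualD lam)).
  - move=> _ _ [z1 ->] [z2 ->]; exists (z1 + z2).
    by rewrite raddfD modquot_piD dualD.
  - move=> a [z [z0 ->]].
    have -> : z = 0 by apply: val_inj; rewrite raddf0 /= -z0.
    by rewrite (morphD0 (@modquot_piD _ _ _)) (morphD0 (dualD lam)).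
have [d dP] := kpair_perfect muD.
have mu_part c : c \in koszul_degree j ->
    kpair b c (koszul_part (s - j) d) = mu c.
  by move=> cj; rewrite dP -kpair_part.
(* The extension [mu] kills boundaries because [lam] is defined on classes; this makes the
   representing chain a cycle. *)
have w_cycle : koszul_part (s - j) d \in koszul_cycle f (s - j).
  apply: kpair_cycle => // [|c cj]; first exact: koszul_part_degree.
  rewrite mu_part ?(koszul_diff_degree f cj) //.
  have dc_cycle : diff c \in koszul_cycle f j.
    by rewrite unfold_in (koszul_diff_degree f cj) koszul_diffK eqxx.
  rewrite (muG _ (lam (modquot_pi _ (Cycle dc_cycle)))); last first.
    by exists (Cycle dc_cycle).
  rewrite -[RHS](morphD0 (dualD lam)); congr (lam _).
  rewrite -[RHS](morphD0 (@modquot_piD _ _ _)); apply/homology_eqP.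
  by exists c => //; rewrite raddf0 addr0.
exists (modquot_pi _ (Cycle w_cycle)); apply/val_inj/funext => x /=.
have [z ->] := modquotW x; rewrite hpairE /= mu_part ?cycle_degree //.
by apply: muG; exists z.
Qed.

(** If [w] were not a boundary, some additive map would kill boundaries but not [w]; the degree [j]
    part of the chain representing it is a cycle, so it pairs to 0 with [w]. *)
Lemma hpair_eq0 y : (forall x, hpair x y = 0) -> y = 0.
Proof.
have [w ->] := modquotW y => w0.
pose N c := exists2 e, e \in koszul_degree (s - j).+1 & c = diff e.
have Nw : N (val w).
  apply: contrapT => /(additive_separation n_gt1 (@alg_torsion _) koszul_finite).
  case=> [|mu muD [muN mu_w]].
    split=> [|_ _ [e1 e1P ->] [e2 e2P ->]].
      by exists 0; rewrite ?rpred0 ?raddf0.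
    by exists (e1 + e2); rewrite ?rpredD ?raddfD.
  have [d dP] := kpair_perfect muD; apply: mu_w.
  have z_cycle : koszul_part j d \in koszul_cycle f j.
    (* [kpair_cycle] is applied with [s - j] for [j], through [s - (s - j) = j]. *)
    rewrite -(subKn j_le_s); apply: kpair_cycle; rewrite ?leq_subr //.
      exact: koszul_part_degree.
    move=> e eP; rewrite -kpair_part ?(koszul_diff_degree f) //.
    by rewrite -dP muN //; exists e.
  rewrite dP (kpair_part _ (cycle_degree w)) subKn // (kpairC bP).
  have := w0 (modquot_pi _ (koszul_sgn R (finset.setTfor 'I_s) *: Cycle z_cycle)).
  by rewrite hpairE linearZ.
rewrite -[RHS](morphD0 (@modquot_piD _ _ _)); apply/homology_eqP.
by case: Nw => e eP we; exists e; rewrite // raddf0 addr0.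
Qed.

Lemma hpair_dual_injective : injective hpair_dual.
Proof.
move=> y1 y2 y12; apply/eqP; rewrite -subr_eq0; apply/eqP/hpair_eq0.
move=> x; rewrite (morphDB (hpairDr x)); apply/eqP; rewrite subr_eq0; apply/eqP.
exact: (congr1 (fun lam : dual (H j) => lam x) y12).
Qed.

Lemma homology_finite i : finite_set [set: H i].
Proof.
have Zfin : finite_set [set: Z i].
  rewrite -(eq_finite_set (inj_card_eq (f := val) _)).
    exact: sub_finite_set koszul_finite.
  by move=> x y _ _; apply: val_inj.
apply: (sub_finite_set _ (finite_image (@modquot_pi _ _ _) Zfin)) => x _.
by have [z ->] := modquotW x; exists z.
Qed.

Lemma leq_card_homology :
  (#|` fset_set [set: H (s - j)]| <= #|` fset_set [set: H j]|)%N.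
Proof.
apply: (@leq_card_additive n (H j) (H (s - j)) (fun y => hpair^~ y)).
- exact: homology_finite.
- exact: homology_finite.
- by move=> y1 y2 y12; apply/hpair_dual_injective/val_inj.
- exact: hpairDl.
Qed.

End HomologyPairing.

Lemma koszul_homology_dual j : (j <= s)%N ->
  lmod_isomorphic (dual (koszul_homology f M j)) (koszul_homology f M (s - j)).
Proof.
move=> j_s; apply: (lmod_isomorphic_inv (hpair_dual_linear (j := j))).
  exact: hpair_dual_injective.
exact: hpair_surjective.
Qed.

Lemma card_koszul_homology j : (j <= s)%N ->
  #|` fset_set [set: koszul_homology f M j]| =
  #|` fset_set [set: koszul_homology f M (s - j)]|.
Proof.
move=> j_s; apply/eqP; rewrite eqn_leq leq_card_homology // andbT.
by have := leq_card_homology (leq_subr j s); rewrite subKn.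
Qed.
End KoszulDuality.

(** * Specialization to the torus ring *)

Lemma torus_trace_form (D n : nat) (L : 'I_D -> nat) :
  @balanced_form (laurent D 'Z_n) (torus_ring 'Z_n L) _
    (fun x y => torus_trace (x * y)).
Proof.
split=> [y x1 x2|x y|r x y]; first by rewrite mulrDl torus_traceD.
  by rewrite mulrC.
by rewrite -[_ *: x]/(_ * x) -[_ *: y]/(_ * y) mulrCA mulrA.
Qed.

Theorem fact5 (p m D s : nat) (f : 'I_s -> laurent D 'Z_(p ^ m))
    (L : 'I_D -> nat) (j : nat) :
  prime p -> (1 <= m)%N -> (forall i, (0 < L i)%N) -> (j <= s)%N ->
  lmod_isomorphic (dual (torus_homology f L j)) (torus_homology f L (s - j))
  /\ torus_log_card p f L j = torus_log_card p f L (s - j).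
Proof.
move=> p_pr m_gt0 L_gt0 j_s.
(* ['Z_n] is Z/n only when [n] exceeds 1. *)
have pm_gt1 : (1 < p ^ m)%N by rewrite -(exp1n m) ltn_exp2r // prime_gt1.
have Tfin := torus_ring_finite 'Z_(p ^ m) L_gt0.
have Tform := @torus_trace_form D (p ^ m) L.
have Tperf lam := @torus_trace_perfect D (p ^ m) L lam L_gt0.
split; first exact: (koszul_homology_dual f pm_gt1 Tfin Tform Tperf j_s).
exact: (congr1 (logn p) (card_koszul_homology f pm_gt1 Tfin Tform Tperf j_s)).
Qed.
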